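(* Let $0\le a<b$ be real numbers, let $f:[a,b]\to\mathbb{R}$ be a differentiable function on $[a,b]$ with $|f'(x)|\le M$ for every $x\in[a,b]$, and let $\alpha\ge 0$. Then $$\left|J_a^{\alpha}f(b)-\frac{(b-a)^{\alpha-1}}{\Gamma(\alpha+1)}\int_a^b f(s)\,ds\right|\le \frac{M(\alpha+3)(b-a)^{\alpha+1}}{2\,\Gamma(\alpha+2)} .$$
   Context: For $a\ge 0$, the Riemann-Liouville fractional integral operator of order $\alpha\ge 0$ is defined by $$J_a^{\alpha}f(x)=\frac{1}{\Gamma(\alpha)}\int_a^x (x-t)^{\alpha-1}f(t)\,dt\quad(\alpha>0),\qquad J_a^{0}f(x)=f(x),$$ where $\Gamma$ is the Gamma function. *)

(* Defs.v *)
From HB Require Import structures.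
From mathcomp Require Import all_boot all_order all_algebra.
From mathcomp Require Import all_classical all_reals all_analysis.

Set Implicit Arguments.
Unset Strict Implicit.
Unset Printing Implicit Defensive.

Import Order.TTheory GRing.Theory Num.Theory.
Import numFieldNormedType.Exports.

Local Open Scope classical_set_scope.
Local Open Scope ring_scope.

Section Defs.
Context {R : realType}.
Implicit Types (A : set R) (f : R -> R) (a s x alpha : R).

(* Integrals are Lebesgue integrals, so integrands that are unbounded near an
   endpoint need no separate improper integral.  The integral below converges
   exactly for 0 < s, the only range in which this value is meaningful. *)
Definition Gamma s : R :=
  \int[lebesgue_measure]_(t in `]0, +oo[) (t `^ (s - 1) * expR (- t)).

(* For 0 < alpha < 1 the kernel is singular at t = x; there powR takes the
   value 0 `^ (alpha - 1) = 0, on a set of measure zero. *)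
Definition RL_integral a alpha f x : R :=
  if alpha == 0 then f x
  else (Gamma alpha)^-1 *
    \int[lebesgue_measure]_(t in `[a, x]) ((x - t) `^ (alpha - 1) * f t).

(* Differentiation of f as a function on A only: the increments stay in A, so
   that for A = `[a, b] the derivatives at a and at b are one-sided. *)
Definition derivable_in A f x : Prop :=
  cvg ((f y - f x) / (y - x) @[y --> within A x^']).

Definition derive_in A f x : R :=
  lim ((f y - f x) / (y - x) @[y --> within A x^']).

End Defs.

(* Main.v *)
Require Import Defs.
From HB Require Import structures.
From mathcomp Require Import all_boot all_order all_algebra.
From mathcomp Require Import all_classical all_reals all_analysis.
From mathcomp Require Import measurable_realfun.
From mathcomp Require Import ring lra.

Import Order.TTheory GRing.Theory Num.Theory.
Import numFieldNormedType.Exports.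

Local Open Scope classical_set_scope.
Local Open Scope ring_scope.

(** Write L = b - a.  Both terms of the difference are compared with the value
    they take on the constant function f(a).  Since f' is bounded by M, the mean
    value theorem gives |f(t) - f(a)| <= M (t - a) on [a, b], and integrating
    this against the positive kernel (b - t)^(s - 1) yields, for every order
    s > 0, the Taylor estimate of order zero

      | J_a^s f(b) - f(a) L^s / Gamma(s + 1) | <= M L^(s + 1) / Gamma(s + 2),

    which is [RL_integral_taylor0]; for s = 0 it is the mean value bound at b,
    because Gamma(1) = Gamma(2) = 1.  Used with s = alpha it controls the first
    term of the difference.  Used with s = 1, where J_a^1 is the plain integral,
    and multiplied by L^(alpha - 1) / Gamma(alpha + 1), it controls the second
    term, with the same main part f(a) L^alpha / Gamma(alpha + 1) and the error
    M L^(alpha + 1) / (2 Gamma(alpha + 1)).  The main parts cancel, and since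
    Gamma(alpha + 2) = (alpha + 1) Gamma(alpha + 1) the two errors add up to
    (1 + (alpha + 1) / 2) M L^(alpha + 1) / Gamma(alpha + 2), the stated bound.

    The analysis needed is the functional equation of Gamma ([GammaD1]) and
    the integral of the kernel ([integral_RL_kernel]).  Both integrands are
    nonnegative and may be singular at an end of the domain, so both integrals
    are limits of integrals over compact intervals on which the fundamental
    theorem of calculus applies. *)

(** * One-sided differentiability and the mean value bound *)

(** The increment f y - f x is the difference quotient, which converges, times
    y - x, which tends to 0. *)
Lemma derivable_in_continuous {R : realType} (A : set R) (f : R -> R) (x : R) :
  derivable_in A f x -> f @ within A (nbhs x) --> f x.
Proof.
move=> df.
have xA : (f y - f x) @[y --> within A x^'] --> 0.
  have -> : 0 = derive_in A f x * 0 by rewrite mulr0.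
  apply: (@cvg_trans _
      (((f y - f x) / (y - x) * (y - x)) @[y --> within A x^'])).
    apply: near_eq_cvg; rewrite !near_withinE.
    by apply: nearW => y yx _; rewrite divfK// subr_eq0.
  apply: cvgM; first exact: df.
  have xx : y - x @[y --> x] --> 0.
    rewrite -[X in _ --> X](subrr x).
    by apply: cvgB; [exact: cvg_id|exact: cvg_cst].
  by do 2 apply: cvg_within_filter.
apply/cvgrPdist_lt => e e0.
move/cvgrPdist_lt : xA => /(_ _ e0).
rewrite !near_withinE => xA; apply: filterS xA => y /=.
have [->|yx] := eqVneq y x; first by rewrite subrr normr0.
by move=> /(_ isT)/[apply]; rewrite sub0r normrN distrC.
Qed.

(** Near an interior point of A the restriction to A is invisible, so that the
    ordinary mean value theorem can be used inside [a, b]. *)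
Lemma is_derive_derive_in {R : realType} (A : set R) (f : R -> R) (x : R) :
  nbhs x A -> derivable_in A f x -> is_derive x 1 f (derive_in A f x).
Proof.
move=> xA df.
have : (f y - f x) / (y - x) @[y --> x^'] --> derive_in A f x.
  apply: cvg_trans df; apply: cvg_app => B /=.
  rewrite !nbhs_simpl/= => AB.
  by apply: filterS2 (nbhs_dnbhs xA) AB => y Ay; exact.
move=> dfx.
have xh : h + x @[h --> 0^'] --> x^'.
  have x0h : h + x @[h --> (0 : R)] --> x.
    rewrite -[X in _ --> X](add0r x).
    by apply: cvgD; [exact: cvg_id|exact: cvg_cst].
  move=> B /x0h /=; rewrite !nbhs_simpl/= => xB.
  by apply: filterS xB => h /= + h0; apply; rewrite -subr_eq0 addrK.
have {}dfx : h^-1 *: (f (h *: 1 + x) - f x) @[h --> 0^'] --> derive_in A f x.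
  apply: cvg_trans (cvg_comp _ _ xh dfx); apply: near_eq_cvg.
  apply: nearW => h /=; rewrite addrK mulrC.
  by congr (_ * (f (_ + _) - _)); rewrite /GRing.scale/= mulr1.
apply: DeriveDef; first by apply/cvg_ex; exists (derive_in A f x).
exact/cvg_lim.
Unshelve. all: by end_near. Qed.

Lemma derive_in_mean_value_le {R : realType} {a b M : R} {f : R -> R} :
  (forall x, x \in `[a, b] -> derivable_in `[a, b] f x) ->
  (forall x, x \in `[a, b] -> `| derive_in `[a, b] f x | <= M) ->
  forall x, x \in `[a, b] -> `|f x - f a| <= M * (x - a).
Proof.
move=> df f'M x; rewrite in_itv/= => /andP[ax xb].
have [c cax ->] : exists2 c, c \in `[a, x] &
    f x - f a = derive_in `[a, b] f c * (x - a).
  apply: MVT_segment => // [c|].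
    rewrite in_itv/= => /andP[ac cx].
    have cb : c < b := lt_le_trans cx xb.
    apply: is_derive_derive_in; last by apply: df; rewrite in_itv/= !ltW.
    apply: (filterS (@subset_itv_oo_cc _ _ a b)).
    by apply: near_in_itvoo; rewrite in_itv/= ac cb.
  apply: (@continuous_subspaceW _ _ _ `[a, b]).
    by apply: subset_itvl; rewrite bnd_simp.
  by apply/subspace_continuousP => c cab; apply/derivable_in_continuous/df.
rewrite normrM (ger0_norm (_ : 0 <= x - a)) ?subr_ge0//.
apply: ler_wpM2r; rewrite ?subr_ge0//; apply: f'M.
move: cax; rewrite !in_itv/= => /andP[-> cx]/=; exact: le_trans cx xb.
Qed.

(** * Integrals as limits over compact intervals *)

(** Monotone convergence along growing compact intervals.  The limit is taken in
    the extended reals, so no integrability of g over A has to be known. *)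
Lemma cvg_integral_exhaustion {R : realType} {A : set R} {u v : R^nat}
    {g : R -> R} :
  nonincreasing_seq u -> nondecreasing_seq v ->
  A = \bigcup_n `[u n, v n]%classic -> measurable_fun A g ->
  (forall x, A x -> 0 <= g x) ->
  (\int[lebesgue_measure]_(x in `[u n, v n]) (g x)%:E @[n --> \oo] -->
   \int[lebesgue_measure]_(x in A) (g x)%:E)%E.
Proof.
move=> nu nv AE mg g0; rewrite AE.
apply: ge0_nondecreasing_set_cvg_integral => //.
- move=> m n mn; rewrite subsetEset; apply: subset_itv; rewrite bnd_simp.
    exact: nu.
  exact: nv.
- move=> n; apply/measurable_EFinP; apply: measurable_funS mg.
    by rewrite AE; apply: bigcup_measurable => k _; exact: measurable_itv.
  by rewrite AE => x; exists n.
- by move=> n x xn; rewrite lee_fin; apply: g0; rewrite AE; exists n.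
Qed.

(** The fundamental theorem for a primitive differentiable up to the endpoints;
    the case u = v is included so that sequences of intervals may start with a
    degenerate one. *)
Lemma is_derive_FTC2 {R : realType} (f F : R -> R) (u v : R) : u <= v ->
  (forall x, u <= x <= v -> is_derive x 1 F (f x)) ->
  (forall x, u <= x <= v -> {for x, continuous f}) ->
  (\int[lebesgue_measure]_(x in `[u, v]) (f x)%:E = (F v - F u)%:E)%E.
Proof.
rewrite le_eqVlt => /predU1P[<- _ _|uv dF cf].
  by rewrite set_itv1 integral_set1 subrr.
have FuvC x : u <= x <= v -> {for x, continuous F}.
  move=> /dF dFx; apply/differentiable_continuous/derivable1_diffP.
  exact: ex_derive.
have uuv : u <= u <= v by rewrite lexx ltW.
have vuv : u <= v <= v by rewrite lexx ltW.
rewrite EFinB; apply: continuous_FTC2 => //.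
- apply/subspace_continuousP => x; rewrite /= in_itv/= => /cf.
  exact: cvg_within_filter.
- split => [x|| ].
  + rewrite in_itv/= => /andP[ux xv]; have := dF x.
    by rewrite !ltW// => /(_ isT) [].
  + exact/cvg_at_right_filter/FuvC.
  + exact/cvg_at_left_filter/FuvC.
- move=> x; rewrite in_itv/= => /andP[ux xv]; have := dF x.
  by rewrite !ltW// => /(_ isT) ?; rewrite derive1E derive_val.
Qed.

Lemma continuous_integrable_itvcc {R : realType} (f : R -> R) (u v : R) :
  (forall x, u <= x <= v -> {for x, continuous f}) ->
  lebesgue_measure.-integrable `[u, v] (EFin \o f).
Proof.
move=> cf; apply: continuous_compact_integrable; first exact: segment_compact.
apply/subspace_continuousP => x; rewrite /= in_itv/= => /cf.
exact: cvg_within_filter.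
Qed.

(** With c = s + 1, the inequality t / c <= exp (t / c) raised to the power c
    reads t^c <= c^c exp t, so that t^s exp (- t) <= c^c / t. *)
Lemma cvg_powR_expRN {R : realType} {s : R} : 0 <= s ->
  t `^ s * expR (- t) @[t --> +oo] --> 0.
Proof.
move=> s0; have s1 : 0 < s + 1 by lra.
set C := (s + 1) `^ (s + 1).
have bnd (t : R) : 0 < t -> 0 <= t `^ s * expR (- t) <= C * t^-1.
  move=> t0; rewrite mulr_ge0 ?powR_ge0 ?expR_ge0//=.
  rewrite expRN ler_pdivrMr ?expR_gt0// mulrAC ler_pdivlMr//.
  rewrite mulrC -{1}(addrK 1 s) mulr_powRB1 ?(ltW t0)//.
  have -> : expR t = expR (t / (s + 1)) `^ (s + 1).
    by rewrite -expRM divfK// gt_eqF.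
  rewrite -powRM ?expR_ge0 ?(ltW s1)//.
  rewrite ge0_ler_powR ?nnegrE ?mulr_ge0 ?expR_ge0 ?(ltW s1) ?(ltW t0)//.
  rewrite mulrC -ler_pdivrMr//.
  by apply: le_trans (expR_ge1Dx _); rewrite lerDr.
apply: (@squeeze_cvgr _ _ _ _ (fun=> 0) (fun t => C * t^-1)).
- by near=> t; apply: bnd; near: t; apply: nbhs_pinfty_gt; exact: num_real.
- exact: cvg_cst.
- rewrite -[X in _ --> X](mulr0 C); apply: cvgM; first exact: cvg_cst.
  by apply/gtr0_cvgV0; [apply: nbhs_pinfty_gt; exact: num_real|exact: cvg_id].
Unshelve. all: by end_near. Qed.

(** * The Gamma function *)

Lemma Gamma_ge0 {R : realType} (s : R) : 0 <= Gamma s.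
Proof.
by apply: Rintegral_ge0 => t _; rewrite mulr_ge0 ?powR_ge0 ?expR_ge0.
Qed.

Lemma measurable_powR_expRN {R : realType} (s : R) (A : set R) :
  measurable_fun A (fun t : R => t `^ s * expR (- t)).
Proof.
apply: (@measurable_funS _ _ _ _ setT) => //.
apply: measurable_funM; first exact: measurable_powR.
by apply: measurableT_comp; [exact: measurable_expR|exact: oppr_measurable].
Qed.

Lemma Gamma1 {R : realType} : Gamma (1 : R) = 1.
Proof.
rewrite /Gamma subrr /Rintegral.
rewrite integral_itv_obnd_cbnd; last first.
  by apply/measurable_EFinP; exact: measurable_powR_expRN.
rewrite -/(Rintegral _ _ _).
under eq_Rintegral do rewrite powRr0 mul1r.
have dexp (x : R) : is_derive x 1 (fun t => - expR (- t)) (expR (- x)).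
  by apply: is_derive_eq; rewrite /GRing.scale/= mulrN1 opprK.
have cexp : continuous (fun t : R => expR (- t)).
  move=> x.
  by apply: continuous_comp; [exact: opp_continuous|exact: continuous_expR].
rewrite (@Rintegral_ge0_continuous_FTC2y _ _ (fun t => - expR (- t)) _ 0).
- by rewrite oppr0 expR0 sub0r opprK.
- by move=> x _; exact: expR_ge0.
- exact: continuous_subspaceT.
- by rewrite -oppr0; apply: cvgN; exact: cvgr_expR.
- by [].
- by apply: cvg_at_right_filter; apply: cvgN; exact: cexp.
- by move=> x _; rewrite derive1E; exact: derive_val.
Qed.

Lemma is_derive_powR_expRN {R : realType} (s : R) {x : R} : 0 < x ->
  is_derive x 1 (fun t => t `^ s * expR (- t))
    (s * (x `^ (s - 1) * expR (- x)) - x `^ s * expR (- x)).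
Proof.
move=> x0; have := @is_derive1_powR R s x x0 => dpow.
by apply: is_derive_eq; rewrite /GRing.scale/=; ring.
Qed.

Lemma continuous_powR_expRN {R : realType} (s : R) {x : R} : 0 < x ->
  {for x, continuous (fun t => t `^ s * expR (- t))}.
Proof.
move=> x0; apply/differentiable_continuous/derivable1_diffP.
by have [] := is_derive_powR_expRN s x0.
Qed.

(** Integration by parts: t^s exp (- t) has derivative
    s t^(s - 1) exp (- t) - t^s exp (- t), and vanishes at 0 and at infinity.
    The identity is first obtained between extended reals, which makes the
    convergence of the integral irrelevant: if it were infinite for s, it would
    be so for s + 1, and both values would be 0 by convention. *)
Lemma GammaD1 {R : realType} (s : R) : 0 < s -> Gamma (s + 1) = s * Gamma s.
Proof.
move=> s0; rewrite /Gamma addrK.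
pose p (t : R) := t `^ (s - 1) * expR (- t).
pose q (t : R) := t `^ s * expR (- t).
rewrite -/(p _) -/(q _).
pose u : R^nat := harmonic; pose v : R^nat := fun n => n.+1%:R.
have u0 n : 0 < u n by rewrite /u invr_gt0.
have uv n : u n <= v n.
  by rewrite (@le_trans _ _ 1)// ?invf_le1 ?ler1n.
have nu : nonincreasing_seq u.
  by move=> m n mn; rewrite /u lef_pV2 ?posrE// ler_nat.
have nv : nondecreasing_seq v by move=> m n mn; rewrite /v ler_nat.
have Auv : `]0, +oo[%classic = \bigcup_n `[u n, v n]%classic :> set R.
  apply/seteqP; split => x /=; rewrite in_itv/= ?andbT.
    move=> x0.
    exists (maxn (Num.truncn x) (Num.truncn x^-1)) => //=.
    rewrite in_itv/= /u /v invf_ple ?posrE//.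
    by apply/andP; split; apply/ltW; rewrite -truncn_le_nat ?leq_maxr ?leq_maxl.
  move=> [n _] /=; rewrite in_itv/= => /andP[+ _]; exact: lt_le_trans.
have cvI := cvg_integral_exhaustion nu nv Auv
  (measurable_powR_expRN (s - 1) _)
  (fun x _ => mulr_ge0 (powR_ge0 _ _) (expR_ge0 _)).
have cvJ := cvg_integral_exhaustion nu nv Auv
  (measurable_powR_expRN s _) (fun x _ => mulr_ge0 (powR_ge0 _ _) (expR_ge0 _)).
have parts n : (s%:E * \int[lebesgue_measure]_(t in `[u n, v n]) (p t)%:E =
    (q (v n) - q (u n))%:E +
    \int[lebesgue_measure]_(t in `[u n, v n]) (q t)%:E)%E.
  have x0 x : u n <= x <= v n -> 0 < x.
    by move=> /andP[+ _]; exact: lt_le_trans.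
  have ip : lebesgue_measure.-integrable `[u n, v n] (EFin \o p).
    apply: continuous_integrable_itvcc => x /x0.
    exact: continuous_powR_expRN.
  have iq : lebesgue_measure.-integrable `[u n, v n] (EFin \o q).
    apply: continuous_integrable_itvcc => x /x0.
    exact: continuous_powR_expRN.
  have ftc : (\int[lebesgue_measure]_(t in `[u n, v n]) (s * p t - q t)%:E =
      (q (v n) - q (u n))%:E)%E.
    apply: is_derive_FTC2 => // x /x0 xgt0; first exact: is_derive_powR_expRN.
    apply: cvgB; last exact: continuous_powR_expRN.
    by apply: cvgM; [exact: cvg_cst|exact: continuous_powR_expRN].
  rewrite -ftc -integralZl//.
  under [X in (_ = X + _)%E]eq_integral do rewrite EFinB EFinM.
  rewrite integralB//; last exact: integrableZl.
  by rewrite subeK// integrable_fin_num.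
have bdry : q (v n) - q (u n) @[n --> \oo] --> 0.
  rewrite -[X in _ --> X](subrr 0); apply: cvgB.
    have /cvg_pinftyP := cvg_powR_expRN (ltW s0); apply.
    by have := @cvgr_idn R; rewrite -(cvg_shiftS (fun n => n%:R : R)).
  have q0 : q t @[t --> 0^'+] --> 0.
    rewrite -[X in _ --> X](mul0r (expR (- 0))); apply: cvgM.
      exact: powR_cvg0.
    apply: cvg_at_right_filter; apply: continuous_comp.
      exact: opp_continuous.
    exact: continuous_expR.
  by move/cvg_at_rightP : q0; apply; split => //; exact: cvg_harmonic.
have sIJ : (s%:E * \int[lebesgue_measure]_(t in `]0%R, +oo[) (p t)%:E =
    \int[lebesgue_measure]_(t in `]0%R, +oo[) (q t)%:E)%E.
  have cvsI := @cvgeZl _ _ _ _ _ s%:E isT cvI.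
  apply: (cvg_unique (@ereal_hausdorff R) cvsI) => /=.
  under eq_cvg do rewrite parts.
  have bdryE : (q (v n) - q (u n))%:E @[n --> \oo] --> 0%:E.
    by apply: cvg_EFin => //; exact: nearW.
  by have := cvgeD (isT : 0%:E +? _)%E bdryE cvJ; rewrite add0e; exact.
rewrite /Rintegral -sIJ.
(* A divergent integral has real value 0, on both sides of the equation. *)
have [pfin|] := boolP ((\int[lebesgue_measure]_(t in `]0%R, +oo[) (p t)%:E)%E
  \is a fin_num); first by rewrite fineM.
rewrite ge0_fin_numE ?integral_ge0// => [|t _]; last first.
  by rewrite lee_fin mulr_ge0 ?powR_ge0 ?expR_ge0.
by rewrite ltey negbK => /eqP ->; rewrite mulry gtr0_sg// mul1e mulr0.
Qed.

(** * The Riemann-Liouville kernel *)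

Section RiemannLiouville.
Context {R : realType}.
Implicit Types (a b s M : R) (f : R -> R).
Local Notation mu := (@lebesgue_measure R).

Lemma integrable_mulrl {a b} (k : R) {f} :
  mu.-integrable `[a, b] (EFin \o f) ->
  mu.-integrable `[a, b] (EFin \o fun t => k * f t).
Proof. exact: (@integrableZl _ _ R mu _ _ k (EFin \o f)). Qed.

Lemma measurable_RL_kernel b s (A : set R) :
  measurable_fun A (fun t => (b - t) `^ (s - 1)).
Proof.
apply: (@measurable_funS _ _ _ _ setT) => //.
apply: (measurableT_comp (measurable_powR _)).
exact: measurable_funB.
Qed.

Lemma is_derive_RL_kernel b s (x : R) : x < b -> s != 0 ->
  is_derive x 1 (fun t => - ((b - t) `^ s / s)) ((b - x) `^ (s - 1)).
Proof.
move=> xb s0; have bx0 : 0 < b - x by rewrite subr_gt0.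
have dpow := @is_derive1_powR R s _ bx0.
have dsub : is_derive x 1 (fun t => b - t) (-1).
  by apply: is_derive_eq; rewrite add0r mul1r.
have dcomp :=
  @is_derive1_comp _ (@powR R ^~ s) (fun t => b - t) x _ _ dpow dsub.
have dscale := is_deriveZ (- s^-1) dcomp.
have -> : (fun t => - ((b - t) `^ s / s)) =
    - s^-1 \*: ((@powR R ^~ s) \o (fun t => b - t)).
  by apply/funext => t; rewrite /= /GRing.scale/=; ring.
apply: is_derive_eq; rewrite /GRing.scale/=.
by field.
Qed.

Lemma continuous_RL_kernel b s (x : R) : x < b ->
  {for x, continuous (fun t => (b - t) `^ (s - 1))}.
Proof.
move=> xb; have bx0 : 0 < b - x by rewrite subr_gt0.
apply: (@continuous_comp _ _ _ (fun t => b - t) (@powR R ^~ (s - 1))).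
  by apply: cvgB; [exact: cvg_cst|exact: cvg_id].
apply/differentiable_continuous/derivable1_diffP/derivable_powR.
by rewrite in_itv/= bx0.
Qed.

(** For s < 1 the kernel is unbounded at b.  It is integrated over
    [a, b - (b - a) / (n + 1)], where - (b - t)^s / s is a smooth primitive, and
    the boundary term at b disappears in the limit because s > 0. *)
Lemma integral_RL_kernel {a b s} : a < b -> 0 < s ->
  (\int[mu]_(t in `[a, b]) ((b - t) `^ (s - 1))%:E = ((b - a) `^ s / s)%:E)%E.
Proof.
move=> ab s0; have ba0 : 0 < b - a by rewrite subr_gt0.
pose F t := - ((b - t) `^ s / s).
pose h n := (b - a) * @harmonic R n.
have h0 n : 0 < h n by rewrite mulr_gt0// invr_gt0.
have abh n : a <= b - h n.
  by rewrite lerBrDl -lerBrDr ler_piMr ?(ltW ba0)// /harmonic invf_le1 ?ler1n.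
have nv : nondecreasing_seq (fun n => b - h n).
  move=> m n mn; rewrite lerD2l lerN2 /h ler_pM2l// lef_pV2 ?posrE//.
  by rewrite ler_nat.
have hcvg : h n @[n --> \oo] --> 0.
  rewrite -[X in _ --> X](mulr0 (b - a)).
  by apply: cvgM; [exact: cvg_cst|exact: cvg_harmonic].
have Aab : `[a, b[%classic = \bigcup_n `[a, b - h n]%classic.
  apply/seteqP; split => x /=; rewrite in_itv/=; last first.
    move=> [n _] /=; rewrite in_itv/= => /andP[-> xn]/=.
    by rewrite (le_lt_trans xn)// ltrBlDr ltrDl.
  move=> /andP[ax xb].
  have /cvgr0Pnorm_lt/(_ (b - x)) := hcvg.
  rewrite subr_gt0 => /(_ xb) [n _ /(_ n (leqnn n))] /=.
  rewrite gtr0_norm// => hn; exists n => //=.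
  by rewrite in_itv/= ax/= ltW// ltrBrDr -ltrBrDl.
rewrite -integral_itv_bndo_bndc; last first.
  by apply/measurable_EFinP; exact: measurable_RL_kernel.
have := cvg_integral_exhaustion (fun m n _ => lexx a) nv Aab
  (measurable_RL_kernel b s _) (fun x _ => powR_ge0 _ _).
move/cvg_unique; apply => //.
have -> :
    (fun n => (\int[mu]_(t in `[a, (b - h n)%R]) ((b - t) `^ (s - 1))%:E)%E) =
    (fun n => (F (b - h n) - F a)%:E).
  apply/funext => n; apply: is_derive_FTC2 => // x /andP[_ xn].
    apply: is_derive_RL_kernel; rewrite ?gt_eqF//.
    by rewrite (le_lt_trans xn)// ltrBlDr ltrDl.
  by apply: continuous_RL_kernel; rewrite (le_lt_trans xn)// ltrBlDr ltrDl.
have Fh n : F (b - h n) - F a = (b - a) `^ s / s - (h n) `^ s / s.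
  by rewrite /F opprK subKr addrC.
apply: cvg_EFin; first exact: nearW.
rewrite (_ : fine \o _ =
    fun n => (b - a) `^ s / s - (h n) `^ s / s); last first.
  by apply/funext => n /=; rewrite Fh.
rewrite -[X in _ --> X]subr0; apply: cvgB; first exact: cvg_cst.
rewrite -[X in _ --> X](mul0r s^-1); apply: cvgM; last exact: cvg_cst.
by have /cvg_at_rightP := powR_cvg0 s0; apply; split.
Qed.

Lemma integrable_RL_kernel {a b s} : a < b -> 0 < s ->
  mu.-integrable `[a, b] (EFin \o fun t => (b - t) `^ (s - 1)).
Proof.
move=> ab s0; apply/integrableP; split.
  by apply/measurable_EFinP; exact: measurable_RL_kernel.
under eq_integral do rewrite /= ger0_norm ?powR_ge0//.
by rewrite integral_RL_kernel// ltry.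
Qed.

(** Writing t - c = (b - c) - (b - t) reduces the first moment of the kernel of
    order s to the masses of the kernels of orders s and s + 1. *)
Lemma RL_kernel_momentE b s (t c : R) : t <= b -> 0 < s ->
  (b - t) `^ (s - 1) * (t - c) =
  (b - c) * (b - t) `^ (s - 1) - (b - t) `^ (s + 1 - 1).
Proof.
move=> tb s0; rewrite addrK -(@mulr_powRB1 _ (b - t) s) ?subr_ge0//; ring.
Qed.

Lemma integrable_RL_kernel_moment {a b s} : a < b -> 0 < s ->
  mu.-integrable `[a, b] (EFin \o fun t => (b - t) `^ (s - 1) * (t - a)).
Proof.
move=> ab s0.
have s1 : 0 < s + 1 by rewrite addr_gt0.
have : mu.-integrable `[a, b] (fun t =>
    ((b - a) * (b - t) `^ (s - 1))%:E - ((b - t) `^ (s + 1 - 1))%:E)%E.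
  apply: integrableB => //; last exact: integrable_RL_kernel.
  exact/integrable_mulrl/integrable_RL_kernel.
apply: eq_integrable => // t; rewrite inE/= in_itv/= => /andP[_ tb].
by rewrite RL_kernel_momentE.
Qed.

Lemma Rintegral_RL_kernel_moment {a b s} : a < b -> 0 < s ->
  \int[mu]_(t in `[a, b]) ((b - t) `^ (s - 1) * (t - a)) =
  (b - a) `^ (s + 1) / (s * (s + 1)).
Proof.
move=> ab s0; have s1 : 0 < s + 1 by rewrite addr_gt0.
have sb : 0 < b - a by rewrite subr_gt0.
transitivity (\int[mu]_(t in `[a, b])
    ((b - a) * (b - t) `^ (s - 1) - (b - t) `^ (s + 1 - 1))).
  apply: eq_Rintegral => t; rewrite inE/= in_itv/= => /andP[_ tb].
  exact: RL_kernel_momentE.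
have iK := integrable_RL_kernel ab s0.
rewrite RintegralB//; last 2 first.
- exact: integrable_mulrl.
- exact: integrable_RL_kernel.
rewrite RintegralZl// /Rintegral !integral_RL_kernel//=.
rewrite -{1}(addrK 1 s) mulrA mulr_powRB1 ?ltW//.
by field; rewrite !gt_eqF.
Qed.

(** Split f t = f a + (f t - f a).  The constant part integrates to
    f a L^s / s, and s Gamma s = Gamma (s + 1); the rest is at most M times the
    first moment of the kernel about a, that is M L^(s + 1) / (s (s + 1)), and
    dividing by Gamma s turns the denominator into Gamma (s + 2). *)
Lemma RL_integral_taylor0 {a b s M f} : a < b -> 0 <= s ->
  measurable_fun `[a, b] f ->
  (forall t, t \in `[a, b] -> `|f t - f a| <= M * (t - a)) ->
  `|RL_integral a s f b - f a * (b - a) `^ s / Gamma (s + 1)| <=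
  M * (b - a) `^ (s + 1) / Gamma (s + 2).
Proof.
move=> ab s_ge0 mf fM; have ba : 0 < b - a by rewrite subr_gt0.
have -> : Gamma (s + 2) = (s + 1) * Gamma (s + 1).
  by rewrite -GammaD1 ?ltr_wpDl// -addrA.
rewrite /RL_integral; case: eqVneq => [->|sn0].
  rewrite powRr0 mulr1 add0r Gamma1 !mulr1 powRr1 ?invr1 ?mulr1 ?(ltW ba)//.
  by apply: fM; rewrite in_itv/= lexx ltW.
have s0 : 0 < s by rewrite lt_neqAle eq_sym sn0.
pose K t := (b - t) `^ (s - 1).
have iK : mu.-integrable `[a, b] (EFin \o K) := integrable_RL_kernel ab s0.
have iKm : mu.-integrable `[a, b] (EFin \o fun t => M * (K t * (t - a))).
  exact/integrable_mulrl/integrable_RL_kernel_moment.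
have KgM t : `[a, b]%classic t -> `|K t * (f t - f a)| <= M * (K t * (t - a)).
  move=> tab; rewrite normrM ger0_norm ?powR_ge0// mulrCA.
  by rewrite ler_wpM2l ?powR_ge0// fM.
have iKg : mu.-integrable `[a, b] (EFin \o fun t => K t * (f t - f a)).
  apply: (le_integrable _ _ _ iKm) => //.
    apply/measurable_EFinP/measurable_funM; first exact: measurable_RL_kernel.
    exact: measurable_funB.
  by move=> t tab; rewrite /= lee_fin (le_trans (KgM t tab))// ler_norm.
have iKfa : mu.-integrable `[a, b] (EFin \o fun t => f a * K t).
  exact: integrable_mulrl.
have -> : \int[mu]_(t in `[a, b]) ((b - t) `^ (s - 1) * f t) =
    \int[mu]_(t in `[a, b]) (K t * (f t - f a)) + f a * ((b - a) `^ s / s).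
  rewrite (_ : (b - a) `^ s / s = \int[mu]_(t in `[a, b]) K t); last first.
    by rewrite /Rintegral integral_RL_kernel.
  rewrite -RintegralZl// -RintegralD//; apply: eq_Rintegral => t _.
  by rewrite /K; ring.
rewrite GammaD1// mulrDr.
rewrite (_ : _ + _ - _ =
    (Gamma s)^-1 * \int[mu]_(t in `[a, b]) (K t * (f t - f a))); last first.
  by rewrite invfM; ring.
rewrite normrM ger0_norm ?invr_ge0 ?Gamma_ge0//.
have -> : M * (b - a) `^ (s + 1) / ((s + 1) * (s * Gamma s)) =
    (Gamma s)^-1 * (M * ((b - a) `^ (s + 1) / (s * (s + 1)))).
  by rewrite !invfM; ring.
rewrite ler_wpM2l ?invr_ge0 ?Gamma_ge0//.
rewrite -Rintegral_RL_kernel_moment// -RintegralZl//; last first.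
  exact: integrable_RL_kernel_moment.
apply: le_trans (le_normr_Rintegral _ iKg) _ => //.
apply: le_Rintegral => //; exact: integrable_norm.
Qed.

Lemma RL_integral1 a b f :
  RL_integral a 1 f b = \int[mu]_(t in `[a, b]) f t.
Proof.
rewrite /RL_integral oner_eq0 Gamma1 invr1 mul1r subrr.
by apply: eq_Rintegral => t _; rewrite powRr0 mul1r.
Qed.

End RiemannLiouville.

Theorem theorem2 (R : realType) (a b M alpha : R) (f : R -> R)
  (a_ge0 : 0 <= a) (ltab : a < b) (alpha_ge0 : 0 <= alpha)
  (f_derivable : forall x, x \in `[a, b] -> derivable_in `[a, b] f x)
  (f'_le : forall x, x \in `[a, b] -> `| derive_in `[a, b] f x | <= M) :
  `| RL_integral a alpha f b
     - (b - a) `^ (alpha - 1) / Gamma (alpha + 1)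
       * \int[lebesgue_measure]_(s in `[a, b]) f s |
  <= M * (alpha + 3) * (b - a) `^ (alpha + 1) / (2 * Gamma (alpha + 2)).
Proof.
have ba : 0 < b - a by rewrite subr_gt0.
have mf : measurable_fun `[a, b] f.
  apply: subspace_continuous_measurable_fun => //.
  apply/subspace_continuousP => x xab.
  exact/derivable_in_continuous/f_derivable.
have flip := derive_in_mean_value_le f_derivable f'_le.
have J1 := RL_integral_taylor0 ltab ler01 mf flip.
have Ja := RL_integral_taylor0 ltab alpha_ge0 mf flip.
have G2 : Gamma (1 + 1 : R) = 1 by rewrite GammaD1// Gamma1 mulr1.
have G3 : Gamma (1 + 2 : R) = 2.
  by rewrite (_ : 1 + 2 = 1 + 1 + 1)// ?GammaD1 ?Gamma1 ?mulr1//; ring.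
have GS : Gamma (alpha + 2) = (alpha + 1) * Gamma (alpha + 1).
  by rewrite -GammaD1 ?ltr_wpDl// -addrA.
have La : (b - a) `^ alpha = (b - a) `^ (alpha - 1) * (b - a).
  rewrite -[in LHS](subrK 1 alpha) [in LHS]powRD ?powRr1 ?(ltW ba)//.
  by rewrite (gt_eqF ba) implybT.
have La1 : (b - a) `^ (alpha + 1) = (b - a) `^ (alpha - 1) * (b - a) ^+ 2.
  rewrite powRD ?(gt_eqF ba) ?implybT// La powRr1 ?(ltW ba)//; ring.
move: J1; rewrite RL_integral1 G2 G3 powRr1 ?(ltW ba)// divr1.
rewrite (_ : 1 + 1 = 2%:R)// powR_mulrn ?(ltW ba)// => J1.
set I := \int[_]_(_ in _) _ in J1 *.
set w := (b - a) `^ (alpha - 1) / Gamma (alpha + 1).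
have w0 : 0 <= w by rewrite divr_ge0 ?powR_ge0 ?Gamma_ge0.
rewrite (_ : _ - w * I = (RL_integral a alpha f b -
    f a * (b - a) `^ alpha / Gamma (alpha + 1)) -
    w * (I - f a * (b - a))); last first.
  by rewrite /w La; ring.
apply: le_trans (ler_normB _ _) _; rewrite normrM (ger0_norm w0).
apply: le_trans (lerD Ja (ler_wpM2l w0 J1)) _.
rewrite le_eqVlt; apply/orP; left; apply/eqP.
rewrite /w GS La1 !invfM.
set g := (Gamma _)^-1; field; lra.
Qed.
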